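(* Let $X$ be a nonempty completely regular space, $E\ne\{0\}$ a Banach space and $D=C(X,E)$. Let $A=C(X,L(E))\subset L(D)$ act by multiplication, $(af)(x)=a(x)f(x)$, let $G$ be a discrete group acting on $X$ by a group of homeomorphisms $\{t_g\}_{g\in G}$ ($t_{gh}=t_g\circ t_h$), and let $T_g$ be the isometry of $D$ given by $(T_gf)(x)=f(t_g^{-1}(x))$. If $G$ acts topologically freely on $X$, then for every nonempty finite set $F\subset G$ and all $a_g\in A$ ($g\in F$) $$\Big\|\sum_{g\in F}a_gT_g\Big\|=\sup_{x\in X}\ \sup_{\{f_g\}_{g\in F}\in S_F(E)}\Big\|\sum_{g\in F}a_g(x)f_g\Big\|=\sup_{x\in X}\ \sup_{\{f_g\}_{g\in F}\in B_F(E)}\Big\|\sum_{g\in F}a_g(x)f_g\Big\|,$$ where the norm on the left is the operator norm in $L(D)$.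
   Context: All Banach spaces are complex and completely regular spaces are Hausdorff. $L(E)$ is the Banach algebra of bounded linear operators on $E$. For a normed space $B$, $C(X,B)$ is the space of bounded continuous functions $X\to B$ with the sup norm. For a finite set $F\subset G$: $B_F(E)=\{\{f_g\}_{g\in F}: f_g\in E,\ \|f_g\|\le1 \text{ for all } g\in F\}$ and $S_F(E)=\{\{f_g\}_{g\in F}: f_g\in E,\ \|f_g\|=1\text{ for all } g\in F\}$. $G$ acts topologically freely if for every $g\in G$, $g\neq e$, the set $X_g=\{x\in X:t_g(x)=x\}$ has empty interior. *)

(* Defs.v *)
From HB Require Import structures.
From mathcomp Require Import all_boot all_order all_algebra finmap.
From mathcomp Require Import complex.
From mathcomp Require Import mathcomp_extra boolp classical_sets functions.
From mathcomp Require Import reals ereal topology normedtype.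

Set Implicit Arguments.
Unset Strict Implicit.
Unset Printing Implicit Defensive.

Import Order.TTheory GRing.Theory Num.Theory.
Import numFieldNormedType.Exports.

Local Open Scope classical_set_scope.
Local Open Scope ring_scope.

Lemma complexReM {R : realType} (k : R[i]) (r : R) :
  (complex.Re `|k| * r)%:C%C = `|k| * r%:C%C.
Proof. by rewrite -[in RHS](RRe_real (normr_real k)) -rmorphM. Qed.

(* In a normed space over the complex field R[i] the norm `|v| takes its values
   in R[i] (with zero imaginary part); rnorm v is the same number, as a real. *)
Section RealNorm.
Context {R : realType} {V : normedModType R[i]}.
Implicit Types v w : V.

Definition rnorm v : R := complex.Re `|v|.

Lemma normE v : `|v| = (rnorm v)%:C%C.
Proof.
by rewrite /rnorm RRe_real.
Qed.

Lemma rnorm_ge0 v : 0 <= rnorm v.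
Proof. by rewrite -ler0c -normE. Qed.

Lemma rnormD v w : rnorm (v + w) <= rnorm v + rnorm w.
Proof. by rewrite -lecR rmorphD/= -!normE ler_normD. Qed.

Lemma rnormZ (k : R[i]) v : rnorm (k *: v) = complex.Re `|k| * rnorm v.
Proof. by apply: complexI; rewrite complexReM -!normE normrZ. Qed.

Lemma rnorm0 : rnorm (0 : V) = 0.
Proof. by rewrite /rnorm normr0. Qed.

Lemma rnorm_eq0 v : rnorm v = 0 -> v = 0.
Proof. by move=> v0; apply/normr0_eq0; rewrite normE v0. Qed.

End RealNorm.

Section BoundedOperators.
Context {R : realType} (V : normedModType R[i]).

Definition bounded_linear : {pred V -> V} := fun f =>
  `[< linear f /\ exists M : R[i], forall v, `|f v| <= M * `|v| >].

Record bounded_operator := BoundedOperator {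
  bounded_operator_fun :> V -> V;
  _ : bounded_operator_fun \in bounded_linear }.

HB.instance Definition _ := [isSub for bounded_operator_fun].
HB.instance Definition _ := [Choice of bounded_operator by <:].

Lemma bounded_linearP (f : V -> V) : reflect
  (linear f /\ exists2 M : R, 0 <= M & forall v, rnorm (f v) <= M * rnorm v)
  (f \in bounded_linear).
Proof.
apply: (iffP (asboolP _)) => -[lf [M]]; last first.
  move=> M0 fM; split=> //; exists M%:C%C => v.
  by rewrite !normE -rmorphM lecR.
move=> fM; split=> //; exists (complex.Re `|M|).
  by rewrite -ler0c RRe_real ?normr_real.
move=> v; rewrite -lecR complexReM -!normE.
rewrite (le_trans (fM v))//.
have := fM v; have [v0|v0] := eqVneq `|v| 0; first by rewrite v0 !mulr0 lexx.
have {}v0 : 0 < `|v| by rewrite lt_def v0 normr_ge0.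
move=> fMv; have M0 : 0 <= M.
  by rewrite -(pmulr_lge0 _ v0) (le_trans _ fMv).
by rewrite (ger0_norm M0).
Qed.

Lemma bounded_linear_submod : submod_closed bounded_linear.
Proof.
split.
  apply/bounded_linearP; split; first by move=> k v w /=; rewrite scaler0 addr0.
  by exists 0 => // v; rewrite rnorm0 mul0r.
move=> k f g /bounded_linearP[lf [M M0 fM]] /bounded_linearP[lg [N N0 gN]].
have k0 : 0 <= complex.Re `|k| by rewrite -ler0c RRe_real ?normr_real.
apply/bounded_linearP; split.
  move=> c v w; change (k *: f (c *: v + w) + g (c *: v + w) =
    c *: (k *: f v + g v) + (k *: f w + g w)).
  by rewrite lf lg !scalerDr !scalerA [c * k]mulrC addrACA.
exists (complex.Re `|k| * M + N); first by rewrite addr_ge0 ?mulr_ge0.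
move=> v; rewrite (le_trans (rnormD _ _))// rnormZ mulrDl lerD//.
by rewrite -mulrA ler_wpM2l.
Qed.

HB.instance Definition _ :=
  GRing.isSubmodClosed.Build _ _ bounded_linear bounded_linear_submod.
HB.instance Definition _ := [SubChoice_isSubLmodule of bounded_operator by <:].

Implicit Types S T : bounded_operator.

Lemma bounded_operator_linear T : linear T.
Proof. by have /bounded_linearP[] := valP T. Qed.

HB.instance Definition _ T :=
  GRing.isLinear.Build R[i] V V _ (T : V -> V) (bounded_operator_linear T).

Lemma bounded_operatorP S T : S = T <-> forall v, S v = T v.
Proof. by split=> [->//|ST]; apply/val_inj/funext. Qed.

Lemma bounded_operatorD S T v : (S + T) v = S v + T v.
Proof. by []. Qed.

Lemma bounded_operatorZ (k : R[i]) T v : (k *: T) v = k *: T v.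
Proof. by []. Qed.

Lemma bounded_operator_sum I (r : seq I) (P : pred I)
    (T : I -> bounded_operator) v :
  (\sum_(i <- r | P i) T i) v = \sum_(i <- r | P i) T i v.
Proof. by elim/big_rec2: _ => // i w S _ <-. Qed.

Lemma bounded_operator_bound T :
  exists2 M : R, 0 <= M & forall v, rnorm (T v) <= M * rnorm v.
Proof. by have /bounded_linearP[] := valP T. Qed.

Lemma bounded_linear_id : idfun \in bounded_linear.
Proof. by apply/bounded_linearP; split=> //; exists 1 => // v; rewrite mul1r. Qed.

Lemma bounded_linear_comp S T : S \o T \in bounded_linear.
Proof.
have [M M0 SM] := bounded_operator_bound S.
have [N N0 TN] := bounded_operator_bound T.
apply/bounded_linearP; split; first by move=> k v w /=; rewrite !linearP.
exists (M * N); first exact: mulr_ge0.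
by move=> v /=; rewrite (le_trans (SM _))// -mulrA ler_wpM2l.
Qed.

Definition bounded_operator_one := BoundedOperator bounded_linear_id.

Definition bounded_operator_mul S T :=
  BoundedOperator (bounded_linear_comp S T).

Fact bounded_operator_mulA : associative bounded_operator_mul.
Proof. by move=> S T U; apply/bounded_operatorP. Qed.

Fact bounded_operator_mul1 : left_id bounded_operator_one bounded_operator_mul.
Proof. by move=> S; apply/bounded_operatorP. Qed.

Fact bounded_operator_1mul : right_id bounded_operator_one bounded_operator_mul.
Proof. by move=> S; apply/bounded_operatorP. Qed.

Fact bounded_operator_mulDl : left_distributive bounded_operator_mul +%R.
Proof. by move=> S T U; apply/bounded_operatorP. Qed.

Fact bounded_operator_mulDr : right_distributive bounded_operator_mul +%R.
Proof. by move=> S T U; apply/bounded_operatorP => v /=; rewrite linearD. Qed.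

HB.instance Definition _ := GRing.Zmodule_isPzRing.Build bounded_operator
  bounded_operator_mulA bounded_operator_mul1 bounded_operator_1mul
  bounded_operator_mulDl bounded_operator_mulDr.

Lemma bounded_operatorM S T v : (S * T) v = S (T v).
Proof. by []. Qed.

Definition opnorm T : R := sup [set rnorm (T v) | v in [set v | rnorm v <= 1]].

Lemma opnorm_has_sup T :
  has_sup [set rnorm (T v) | v in [set v | rnorm v <= 1]].
Proof.
split; first by exists (rnorm (T 0)), 0 => //=; rewrite rnorm0.
have [M M0 TM] := bounded_operator_bound T.
exists M => _ [v /= v1 <-]; rewrite (le_trans (TM v))//.
by rewrite -[leRHS]mulr1 ler_wpM2l.
Qed.

Lemma opnorm_ge0 T : 0 <= opnorm T.
Proof.
rewrite -(@rnorm0 R V) -[X in rnorm X](linear0 T).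
apply: ub_le_sup; first by case: (opnorm_has_sup T).
by exists 0 => //=; rewrite rnorm0.
Qed.

Lemma opnormP T v : rnorm (T v) <= opnorm T * rnorm v.
Proof.
have [/rnorm_eq0->|v0] := eqVneq (rnorm v) 0.
  by rewrite linear0 rnorm0 mulr0.
have {}v0 : 0 < rnorm v by rewrite lt_def v0 rnorm_ge0.
rewrite -ler_pdivrMr//.
have Zv w : rnorm ((rnorm v)^-1%:C%C *: w) = rnorm w / rnorm v.
  rewrite rnormZ mulrC; congr (_ * _); apply: complexI.
  by rewrite RRe_real ?normr_real// ger0_norm// lecR invr_ge0 ltW.
apply: ub_le_sup; first by case: (opnorm_has_sup T).
exists ((rnorm v)^-1%:C%C *: v) => /=; first by rewrite Zv divff ?gt_eqF.
by rewrite linearZ/= Zv.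
Qed.

Lemma opnorm_le T (M : R) :
  0 <= M -> (forall v, rnorm (T v) <= M * rnorm v) -> opnorm T <= M.
Proof.
move=> M0 TM; apply: ge_sup; first by case: (opnorm_has_sup T).
move=> _ [v /= v1 <-]; rewrite (le_trans (TM v))//.
by rewrite -[leRHS]mulr1 ler_wpM2l.
Qed.

Fact opnormC_triangle S T :
  (opnorm (S + T))%:C%C <= (opnorm S)%:C%C + (opnorm T)%:C%C :> R[i].
Proof.
rewrite -rmorphD lecR opnorm_le ?addr_ge0 ?opnorm_ge0// => v.
by rewrite mulrDl (le_trans (rnormD _ _))// lerD ?opnormP.
Qed.

Fact opnormC_scale (k : R[i]) T :
  (opnorm (k *: T))%:C%C = `|k| * (opnorm T)%:C%C :> R[i].
Proof.
have k0 (c : R[i]) : 0 <= complex.Re `|c| by rewrite -ler0c RRe_real ?normr_real.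
have le_scale c S : opnorm (c *: S) <= complex.Re `|c| * opnorm S.
  apply: opnorm_le => [|v]; first by rewrite mulr_ge0 ?opnorm_ge0.
  by rewrite bounded_operatorZ rnormZ -mulrA ler_wpM2l ?opnormP.
rewrite -complexReM; congr (_%:C%C).
apply/eqP; rewrite eq_le le_scale andTb.
have [->|kn0] := eqVneq k 0.
  by rewrite normr0 mul0r opnorm_ge0.
have {}kn0 : 0 < complex.Re `|k|.
  by rewrite -ltcR RRe_real ?normr_real// normr_gt0.
rewrite -ler_pdivlMl// -[in leLHS](scale1r T).
have := le_scale k^-1 (k *: T); rewrite scalerA mulVf; last first.
  by apply: contraTneq kn0 => ->; rewrite normr0 ltxx.
move=> /le_trans; apply; rewrite le_eqVlt; apply/orP; left; apply/eqP.
congr (_ * _); apply: complexI.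
by rewrite fmorphV !RRe_real ?normr_real// normfV.
Qed.

Fact opnormC_eq0 T : (opnorm T)%:C%C = 0 :> R[i] -> T = 0.
Proof.
move=> /complexI T0; apply/bounded_operatorP => v; apply: rnorm_eq0.
by apply/eqP; rewrite eq_le rnorm_ge0 andbT (le_trans (opnormP T v))// T0 mul0r.
Qed.

HB.instance Definition _ := Lmodule_isNormed.Build R[i] bounded_operator
  opnormC_triangle opnormC_scale opnormC_eq0.

Lemma rnorm_opnorm T : rnorm T = opnorm T.
Proof. by []. Qed.

End BoundedOperators.

Notation "''L' ( V )" := (bounded_operator V)
  (at level 8, format "''L' ( V )") : type_scope.

Lemma continuous_rnormP {R : realType} {X : topologicalType}
    {V : normedModType R[i]} (f : X -> V) (x : X) :
  {for x, continuous f} <->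
  forall e : R, 0 < e -> \forall y \near x, rnorm (f x - f y) < e.
Proof.
split=> [/cvgrPdist_lt fx e e0|fx].
  have e0C : (0 : R[i]) < e%:C%C by rewrite (ltcR 0 e).
  by near do rewrite -ltcR -normE; exact: fx.
apply/cvgrPdist_lt => e e0.
have eE : e = (complex.Re e)%:C%C by rewrite RRe_real// gtr0_real.
have {}e0 : 0 < complex.Re e by rewrite -ltcR -eE.
near=> y; rewrite normE eE ltcR; near: y; exact: fx.
Unshelve. all: by end_near. Qed.

Section BoundedContinuousFunctions.
Context {R : realType} (X : topologicalType) (B : normedModType R[i]).

Definition continuous_bounded : {pred X -> B} := fun f =>
  `[< continuous f /\ bounded_fun f >].

Record bounded_continuous := BoundedContinuous {
  bounded_continuous_fun :> X -> B;
  _ : bounded_continuous_fun \in continuous_bounded }.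

HB.instance Definition _ := [isSub for bounded_continuous_fun].
HB.instance Definition _ := [Choice of bounded_continuous by <:].

Lemma continuous_boundedP (f : X -> B) : reflect
  (continuous f /\ exists2 M : R, 0 <= M & forall x, rnorm (f x) <= M)
  (f \in continuous_bounded).
Proof.
apply: (iffP (asboolP _)) => -[cf].
  move=> /pinfty_ex_gt0[M M0 fM]; split=> //.
  have ME : M = (complex.Re M)%:C%C by rewrite RRe_real// gtr0_real.
  exists (complex.Re M); first by rewrite -ler0c -ME ltW.
  by move=> x; rewrite -lecR -ME -normE; exact: fM.
move=> [M M0 fM]; split=> //; rewrite /= /bounded_near; near=> N => x _ /=.
rewrite (@le_trans _ _ M%:C%C)//; first by rewrite normE lecR.
near: N; apply: nbhs_pinfty_ge; apply/complex_realP; by exists M.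
Unshelve. all: by end_near. Qed.

Lemma continuous_bounded_submod : submod_closed continuous_bounded.
Proof.
split.
  apply/continuous_boundedP; split; first exact: cst_continuous.
  by exists 0 => // x; rewrite rnorm0.
move=> k f g /continuous_boundedP[cf [M M0 fM]].
move=> /continuous_boundedP[cg [N N0 gN]].
have k0 : 0 <= complex.Re `|k| by rewrite -ler0c RRe_real ?normr_real.
apply/continuous_boundedP; split.
  by move=> x; apply: cvgD; [apply: cvgZr; exact: cf|exact: cg].
exists (complex.Re `|k| * M + N); first by rewrite addr_ge0 ?mulr_ge0.
move=> x; rewrite (le_trans (rnormD _ _))// rnormZ lerD//.
by rewrite ler_wpM2l.
Qed.

HB.instance Definition _ := GRing.isSubmodClosed.Build _ _ continuous_bounded
  continuous_bounded_submod.
HB.instance Definition _ := [SubChoice_isSubLmodule of bounded_continuous by <:].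

Implicit Types f g : bounded_continuous.

Lemma bounded_continuousP f g : f = g <-> forall x, f x = g x.
Proof. by split=> [->//|fg]; apply/val_inj/funext. Qed.

Lemma bounded_continuousD f g x : (f + g) x = f x + g x.
Proof. by []. Qed.

Lemma bounded_continuousZ (k : R[i]) f x : (k *: f) x = k *: f x.
Proof. by []. Qed.

Lemma bounded_continuous_sum I (r : seq I) (P : pred I)
    (f : I -> bounded_continuous) x :
  (\sum_(i <- r | P i) f i) x = \sum_(i <- r | P i) f i x.
Proof. by elim/big_rec2: _ => // i w g _ <-. Qed.

Lemma bounded_continuous_continuous f : continuous f.
Proof. by have /continuous_boundedP[] := valP f. Qed.

Lemma bounded_continuous_bound f :
  exists2 M : R, 0 <= M & forall x, rnorm (f x) <= M.
Proof. by have /continuous_boundedP[] := valP f. Qed.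

Definition supnorm f : R := sup [set rnorm (f x) | x in [set: X]].

Lemma supnormP f x : rnorm (f x) <= supnorm f.
Proof.
have [M M0 fM] := bounded_continuous_bound f.
by apply: ub_le_sup; [exists M => _ [y _ <-]|exists x].
Qed.

Lemma supnorm_le f (M : R) :
  0 <= M -> (forall x, rnorm (f x) <= M) -> supnorm f <= M.
Proof.
move=> M0 fM; rewrite /supnorm.
have [->|/set0P ne] := eqVneq [set rnorm (f x) | x in [set: X]] set0.
  by rewrite sup0.
by apply: ge_sup => // _ [x _ <-].
Qed.

Lemma supnorm_ge0 f : 0 <= supnorm f.
Proof.
rewrite /supnorm.
have [->|/set0P[_ [x _ _]]] := eqVneq [set rnorm (f x) | x in [set: X]] set0.
  by rewrite sup0.
exact: le_trans (rnorm_ge0 _) (supnormP f x).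
Qed.

Fact supnormC_triangle f g :
  (supnorm (f + g))%:C%C <= (supnorm f)%:C%C + (supnorm g)%:C%C :> R[i].
Proof.
rewrite -rmorphD lecR supnorm_le ?addr_ge0 ?supnorm_ge0// => x.
by rewrite (le_trans (rnormD _ _))// lerD ?supnormP.
Qed.

Fact supnormC_scale (k : R[i]) f :
  (supnorm (k *: f))%:C%C = `|k| * (supnorm f)%:C%C :> R[i].
Proof.
have k0 (c : R[i]) : 0 <= complex.Re `|c| by rewrite -ler0c RRe_real ?normr_real.
have le_scale c g : supnorm (c *: g) <= complex.Re `|c| * supnorm g.
  apply: supnorm_le => [|x]; first by rewrite mulr_ge0 ?supnorm_ge0.
  by rewrite bounded_continuousZ rnormZ ler_wpM2l ?supnormP.
rewrite -complexReM; congr (_%:C%C).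
apply/eqP; rewrite eq_le le_scale andTb.
have [->|kn0] := eqVneq k 0.
  by rewrite normr0 mul0r supnorm_ge0.
have {}kn0 : 0 < complex.Re `|k|.
  by rewrite -ltcR RRe_real ?normr_real// normr_gt0.
rewrite -ler_pdivlMl// -[in leLHS](scale1r f).
have := le_scale k^-1 (k *: f); rewrite scalerA mulVf; last first.
  by apply: contraTneq kn0 => ->; rewrite normr0 ltxx.
move=> /le_trans; apply; rewrite le_eqVlt; apply/orP; left; apply/eqP.
congr (_ * _); apply: complexI.
by rewrite fmorphV !RRe_real ?normr_real// normfV.
Qed.

Fact supnormC_eq0 f : (supnorm f)%:C%C = 0 :> R[i] -> f = 0.
Proof.
move=> /complexI f0; apply/bounded_continuousP => x; apply: rnorm_eq0.
by apply/eqP; rewrite eq_le rnorm_ge0 andbT (le_trans (supnormP f x))// f0.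
Qed.

HB.instance Definition _ := Lmodule_isNormed.Build R[i] bounded_continuous
  supnormC_triangle supnormC_scale supnormC_eq0.

Lemma rnorm_supnorm f : rnorm f = supnorm f.
Proof. by []. Qed.

End BoundedContinuousFunctions.

Notation "''Cb' ( X , B )" := (bounded_continuous X B)
  (at level 8, format "''Cb' ( X ,  B )") : type_scope.

Record homeomorphism (X : topologicalType) := Homeomorphism {
  homeo_fun :> X -> X;
  homeo_inv : X -> X;
  homeo_continuous : continuous homeo_fun;
  homeo_inv_continuous : continuous homeo_inv;
  homeoK : cancel homeo_fun homeo_inv;
  homeo_invK : cancel homeo_inv homeo_fun }.

Section OperatorsOnContinuousFunctions.
Context {R : realType} {X : topologicalType} {E : normedModType R[i]}.
Local Notation D := 'Cb(X, E).

Section Multiplication.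
Variable a : 'Cb(X, 'L(E)).

Lemma multiplication_subproof (f : D) :
  (fun x => a x (f x)) \in @continuous_bounded R X E.
Proof.
have [M M0 aM] := bounded_continuous_bound a.
have [N N0 fN] := bounded_continuous_bound f.
apply/continuous_boundedP; split; last first.
  exists (M * N); first exact: mulr_ge0.
  move=> x; rewrite (le_trans (opnormP _ _))//.
  by rewrite ler_pM ?opnorm_ge0 ?rnorm_ge0//; exact: aM.
move=> x; apply/continuous_rnormP => e e0.
have e2N : 0 < e / 2 / (N + 1) by rewrite !divr_gt0 ?ltr_wpDl.
have e2M : 0 < e / 2 / (M + 1) by rewrite !divr_gt0 ?ltr_wpDl.
have ax := @bounded_continuous_continuous _ _ _ a x.
have fx := @bounded_continuous_continuous _ _ _ f x.
have {}ax := (continuous_rnormP a x).1 ax _ e2N.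
have {}fx := (continuous_rnormP f x).1 fx _ e2M.
near=> y.
have -> : a x (f x) - a y (f y) = (a x - a y) (f x) + a y (f x - f y).
  rewrite linearB.
  change (a x (f x) - a y (f y) =
    (a x (f x) - a y (f x)) + (a y (f x) - a y (f y))).
  by rewrite subrKA.
rewrite (le_lt_trans (rnormD _ _))// [ltRHS]splitr ltrD//.
- rewrite (le_lt_trans (opnormP _ _))//.
  rewrite (@le_lt_trans _ _ (opnorm (a x - a y) * (N + 1)))//.
    by rewrite ler_wpM2l ?opnorm_ge0// (le_trans (fN x))// lerDl.
  rewrite -ltr_pdivlMr ?ltr_wpDl//; near: y; exact: ax.
- rewrite (le_lt_trans (opnormP _ _))//.
  rewrite (@le_lt_trans _ _ ((M + 1) * rnorm (f x - f y)))//.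
    by rewrite ler_wpM2r ?rnorm_ge0// (le_trans (aM y))// lerDl.
  rewrite mulrC -ltr_pdivlMr ?ltr_wpDl//; near: y; exact: fx.
Unshelve. all: by end_near. Qed.

Definition multiplication_fun (f : D) : D :=
  BoundedContinuous (multiplication_subproof f).

Lemma multiplication_bounded_linear :
  multiplication_fun \in @bounded_linear R D.
Proof.
apply/bounded_linearP; split.
  by move=> k f g; apply/bounded_continuousP => x /=; rewrite linearP.
exists (supnorm a); first exact: supnorm_ge0.
move=> f; apply: supnorm_le => [|x]; first by rewrite mulr_ge0 ?supnorm_ge0.
rewrite (le_trans (opnormP _ _))// ler_pM ?opnorm_ge0 ?rnorm_ge0//.
- exact: (supnormP a x).
- exact: supnormP.
Qed.

Definition multiplication : 'L(D) :=
  BoundedOperator multiplication_bounded_linear.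

Lemma multiplicationE f x : multiplication f x = a x (f x).
Proof. by []. Qed.

End Multiplication.

Section Translation.
Variable t : homeomorphism X.

Lemma translation_subproof (f : D) :
  (fun x => f (homeo_inv t x)) \in @continuous_bounded R X E.
Proof.
have [N N0 fN] := bounded_continuous_bound f.
apply/continuous_boundedP; split; last by exists N.
move=> x; apply: continuous_comp; first exact: homeo_inv_continuous.
exact: bounded_continuous_continuous.
Qed.

Definition translation_fun (f : D) : D :=
  BoundedContinuous (translation_subproof f).

Lemma translation_bounded_linear : translation_fun \in @bounded_linear R D.
Proof.
apply/bounded_linearP; split.
  by move=> k f g; apply/bounded_continuousP => x /=.
exists 1 => // f; rewrite mul1r.
by apply: supnorm_le => [|x]; [exact: supnorm_ge0|exact: (supnormP f _)].
Qed.

Definition translation : 'L(D) := BoundedOperator translation_bounded_linear.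

Lemma translationE f x : translation f x = f (homeo_inv t x).
Proof. by []. Qed.

End Translation.

End OperatorsOnContinuousFunctions.

Definition topologically_free (G : groupType) (X : topologicalType)
    (t : G -> homeomorphism X) :=
  forall g : G, g <> 1%g -> interior [set x | t g x = x] = set0.

Section Families.
Context {R : realType} {G : groupType} (F : {fset G}) (E : normedModType R[i]).

Definition ball_family : set (F -> E) := [set f | forall g, `|f g| <= 1].

Definition sphere_family : set (F -> E) := [set f | forall g, `|f g| = 1].

End Families.
Arguments ball_family {R G} F E.
Arguments sphere_family {R G} F E.

(* Main.v *)
(* At a point x the operator sees only the values of f at the points
   t_g^-1 x, which form an element of the ball family: this bounds the operator
   norm from above.  Conversely, let (f_g) be a family in the ball at x.  The
   fixed-point sets of the t_(h g^-1), g <> h, are closed and nowhere dense, so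
   arbitrarily close to x there is a y whose points t_g^-1 y are pairwise
   distinct; complete regularity gives a function of norm at most 1 with value
   f_g at t_g^-1 y.  Finally, every vector of the complex unit ball is the
   midpoint of two unit vectors, so by convexity spheres give the same
   supremum as balls. *)
Require Import Defs.
From HB Require Import structures.
From mathcomp Require Import all_boot all_order all_algebra finmap.
From mathcomp Require Import complex ring.
From mathcomp Require Import cardinality.
From mathcomp Require Import mathcomp_extra boolp classical_sets functions.
From mathcomp Require Import reals ereal topology normedtype.

Set Implicit Arguments.
Unset Strict Implicit.
Unset Printing Implicit Defensive.

Import Order.TTheory GRing.Theory Num.Theory.
Import numFieldNormedType.Exports.

Local Open Scope classical_set_scope.
Local Open Scope ring_scope.

Lemma rnorm_le1 {R : realType} {V : normedModType R[i]} (v : V) :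
  (rnorm v <= 1) = (`|v| <= 1).
Proof. by rewrite normE -lecR. Qed.

Lemma Re_norm_real {R : realType} (r : R) : complex.Re `|r%:C%C| = `|r|.
Proof.
by rewrite normc_def /= expr0n addr0 sqrtr_sqr.
Qed.

Lemma rnorm_sum {R : realType} {V : normedModType R[i]} (I : Type)
    (r : seq I) (P : pred I) (f : I -> V) :
  rnorm (\sum_(i <- r | P i) f i) <= \sum_(i <- r | P i) rnorm (f i).
Proof.
elim/big_rec2: _ => [|i x v _ vx]; first by rewrite rnorm0.
by rewrite (le_trans (rnormD _ _))// lerD2l.
Qed.

(** If [s x] and [x] differ, they have disjoint open neighbourhoods; for [y] near [x], [s y] lies in
    the first and [y] in the second, so [s y = y] is impossible. *)
Lemma closed_fixed_points {X : topologicalType} (s : X -> X) :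
  hausdorff_space X -> continuous s -> closed [set x | s x = x].
Proof.
rewrite open_hausdorff => hX cs; rewrite -openC openE => x /= /eqP sx.
have [[A B] /= [sxA xB] [oA oB /eqP AB0]] := hX _ _ sx.
rewrite /interior; near=> y => /= sy.
suff : (A `&` B) y by rewrite AB0.
split; last by near: y; apply: open_nbhs_nbhs; split => //; rewrite inE in xB.
rewrite -sy; near: y; apply: cs; apply: open_nbhs_nbhs; split => //.
by rewrite inE in sxA.
Unshelve. all: by end_near. Qed.

(** Induction on [s] with [U] varying: removing one closed set with empty interior from a nonempty
    open set leaves a nonempty open set. *)
Lemma open_avoid_nowhere_dense {X : topologicalType} {I : eqType} (s : seq I)
    (A : I -> set X) (U : set X) :
  (forall i, i \in s -> closed (A i)) ->
  (forall i, i \in s -> (A i)° = set0) ->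
  open U -> U !=set0 ->
  exists2 y, U y & forall i, i \in s -> ~ A i y.
Proof.
elim: s U => [|i s IHs] U cA A0 oU [x Ux]; first by exists x.
have [||||y [Uy Aiy] sy] := IHs (U `&` ~` A i).
- by move=> j js; apply: cA; rewrite inE js orbT.
- by move=> j js; apply: A0; rewrite inE js orbT.
- by apply: openI => //; apply/closed_openC/cA; rewrite mem_head.
- apply: contrapT => /set0P/negP/negPn/eqP/disjoints_subset.
  rewrite setCK => UA.
  have : (A i)° x by move: UA; rewrite (open_subsetE _ oU); exact.
  by rewrite A0// mem_head.
by exists y => // j; rewrite inE => /predU1P[->|/sy].
Qed.

(** * Bounded continuous functions with prescribed values at finitely many points *)

Section Interpolation.
Context {R : realType} {X : topologicalType}.

(* Bump functions [q i] with [q i (y j) = (i == j)] are divided by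
   [max 1 (\sum_i q i)], which is 1 at every [y j]. *)
Lemma partition_at_points (I : finType) (y : I -> X) :
  hausdorff_space X -> completely_regular_space X -> injective y ->
  exists p : I -> X -> R, [/\ forall i, continuous (p i : X -> R),
    forall i x, 0 <= p i x, forall x, \sum_i p i x <= 1 &
    forall i j, p i (y j) = (i == j)%:R].
Proof.
move=> hX cX yI.
have bump i : {q : X -> R | [/\ continuous q, forall x, 0 <= q x &
    forall j, q (y j) = (i == j)%:R]}.
  (* [B] is finite, hence closed, and misses [y i] by injectivity; complete regularity then
     separates the two. *)
  apply: cid; pose B := y @` [set j | j != i].
  have cB : closed B.
    apply: (accessible_finite_set_closed.1 (hausdorff_accessible hX)).
    exact/finite_image/finite_finset.
  have nB : ~ B (y i) by move=> [j /= /eqP ji /yI].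
  have /(@uniform_separatorP _ R)[q [cq q01 q0 q1]] := cX _ _ cB nB.
  (* The separating [q] is 0 at [y i] and 1 on [B], the reverse of what a bump needs. *)
  exists (fun x => 1 - q x); split => [x|x|j].
  - by apply: cvgB; [exact: cvg_cst|exact: cq].
  - have /q01 : range q (q x) by exists x.
    by rewrite /= in_itv/= subr_ge0 => /andP[].
  - have [<-|ij] := eqVneq i j.
      have -> : q (y i) = 0 by apply: q0; exists (y i).
      by rewrite subr0.
    have -> : q (y j) = 1.
      by apply: q1; exists (y j) => //; exists j => //=; rewrite eq_sym.
    by rewrite subrr.
pose q i := sval (bump i).
have qc i : continuous (q i) by have [] := svalP (bump i).
have q0 i x : 0 <= q i x by have [_ + _] := svalP (bump i); exact.
have qy i j : q i (y j) = (i == j)%:R by have [_ _] := svalP (bump i); exact.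
pose m x := Num.max 1 (\sum_i q i x).
have m0 x : 0 < m x by rewrite lt_max ltr01.
exists (fun i x => q i x / m x); split => [i x|i x|x|i j].
- apply: cvgM; first exact: qc.
  apply: cvgV; first by rewrite gt_eqF.
  apply: (@continuous_max R X (cst 1) (fun x => \sum_i q i x)).
    exact: cvg_cst.
  apply: cvg_big => [|k _]; last exact: qc.
  exact: add_continuous.
- by rewrite divr_ge0// ltW.
- by rewrite -mulr_suml ler_pdivrMr// mul1r le_max lexx orbT.
- rewrite qy /m (bigD1 j)//= qy eqxx big1 ?addr0 ?maxxx ?divr1// => k kj.
  by rewrite qy (negbTE kj).
Qed.

Variable E : normedModType R[i].

Lemma scalar_multiple_continuous_bounded (p : X -> R) (v : E) :
  continuous p -> (forall x, `|p x| <= 1) ->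
  (fun x => (p x)%:C%C *: v) \in @continuous_bounded R X E.
Proof.
move=> cp p1; apply/continuous_boundedP; split; last first.
  exists (rnorm v) => [|x]; first exact: rnorm_ge0.
  by rewrite rnormZ Re_norm_real ler_piMl ?rnorm_ge0.
move=> x; apply/continuous_rnormP => e e0.
(* The added 1 keeps the divisor positive when [v] is zero. *)
have v1 : 0 < rnorm v + 1 by rewrite ltr_wpDl ?rnorm_ge0.
near=> y; rewrite -scalerBl -rmorphB rnormZ Re_norm_real.
rewrite (@le_lt_trans _ _ (`|p x - p y| * (rnorm v + 1)))//.
  by rewrite ler_wpM2l// lerDl.
rewrite -ltr_pdivlMr//; near: y.
have /cvgrPdist_lt := cp x; apply; exact: divr_gt0.
Unshelve. all: by end_near. Qed.

(** Take the sum of the [p i] times [v i]: [\sum_i p i x <= 1] bounds its norm, and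
    [p i (y j) = (i == j)] gives its values. *)
Lemma interpolation (I : finType) (y : I -> X) (v : I -> E) :
  hausdorff_space X -> completely_regular_space X -> injective y ->
  (forall i, rnorm (v i) <= 1) ->
  exists2 f : 'Cb(X, E), rnorm f <= 1 & forall i, f (y i) = v i.
Proof.
move=> hX cX yI v1.
have [p [pc p0 ps py]] := partition_at_points hX cX yI.
have p1 i x : `|p i x| <= 1.
  rewrite ger0_norm// (le_trans _ (ps x))// (bigD1 i)//= lerDl.
  exact: sumr_ge0.
exists (\sum_i BoundedContinuous
    (scalar_multiple_continuous_bounded (v i) (pc i) (p1 i))).
  rewrite rnorm_supnorm; apply: supnorm_le => // x.
  rewrite bounded_continuous_sum (le_trans (rnorm_sum _ _ _))//.
  rewrite (le_trans _ (ps x))//; apply: ler_sum => i _ /=.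
  by rewrite rnormZ Re_norm_real ger0_norm// ler_piMr.
move=> i; rewrite bounded_continuous_sum (bigD1 i)//= py eqxx scale1r.
rewrite big1 ?addr0// => j ji.
by rewrite py (negbTE ji) scale0r.
Qed.

End Interpolation.

(** * Unit vectors in a complex normed space *)

Section BallSphere.
Context {R : realType} {E : normedModType R[i]}.

Lemma unit_vector : (exists v : E, v != 0) -> exists u : E, `|u| = 1.
Proof.
move=> [v v0]; exists (`|v|^-1 *: v).
by rewrite normrZ normfV normr_id mulVf// normr_eq0.
Qed.

(* With [v = r u], [0 <= r <= 1] and [u] a unit vector, the two unit vectors
   are [(r +- i sqrt (1 - r^2)) u]. *)
Lemma ball_midpoint_sphere (v : E) : (exists w : E, w != 0) -> `|v| <= 1 ->
  exists w : E * E, [/\ `|w.1| = 1, `|w.2| = 1 & v = 2^-1 *: (w.1 + w.2)].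
Proof.
move=> E0 v1.
have [u [r [r0 r1 u1 vE]]] : exists u : E, exists r : R,
    [/\ 0 <= r, r <= 1, `|u| = 1 & v = r%:C%C *: u].
  have [->|v0] := eqVneq v 0.
    have [u u1] := unit_vector E0; exists u, 0; split => //.
    by rewrite scale0r.
  exists (`|v|^-1 *: v), (rnorm v); split => //.
  - exact: rnorm_ge0.
  - by rewrite rnorm_le1.
  - by rewrite normrZ normfV normr_id mulVf// normr_eq0.
  - by rewrite -normE scalerA mulfV ?scale1r// normr_eq0.
pose s := Num.sqrt (1 - r ^+ 2).
have s2 : s ^+ 2 = 1 - r ^+ 2.
  by rewrite sqr_sqrtr// subr_ge0 expr_le1.
have n1 (c : R[i]) : complex.Re c = r -> complex.Im c ^+ 2 = s ^+ 2 ->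
    `|c *: u| = 1.
  move=> cr cs; rewrite normrZ u1 mulr1 normc_def cr cs s2 addrC subrK.
  by rewrite sqrtr1.
exists ((r +i* s)%C *: u, (r -i* s)%C *: u); split => /=.
- exact: n1.
- by apply: n1 => //=; rewrite sqrrN.
- rewrite -scalerDl scalerA vE; congr (_ *: u).
  apply: (@mulfI _ 2) => //; rewrite mulrA mulfV// mul1r.
  rewrite [RHS]complexE.
  by apply/eqP; rewrite eq_complex/=; apply/andP; split; apply/eqP; ring.
Qed.

End BallSphere.

(** The preimages of [y] under [t g] and [t h] coincide only if [t (h * g^-1)] fixes [y], so [y]
    need only avoid finitely many fixed-point sets, closed and, by freeness, with empty interior. *)
Lemma free_orbit {X : topologicalType} {G : groupType}
    (t : G -> homeomorphism X) (F : {fset G}) (U : set X) :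
  hausdorff_space X ->
  (forall g h : G, t (g * h)%g = t g \o t h :> (X -> X)) ->
  topologically_free t -> open U -> U !=set0 ->
  exists2 y, U y & injective (fun g : F => homeo_inv (t (val g)) y).
Proof.
move=> hX tM t_free oU U0.
pose s := [seq p <- enum {: F * F} | p.1 != p.2].
pose A (p : F * F) := [set x | t (val p.2 * (val p.1)^-1)%g x = x].
have [||y Uy Ay] := @open_avoid_nowhere_dense X _ s A U _ _ oU U0.
- by move=> p _; apply: closed_fixed_points => //; exact: homeo_continuous.
- move=> p; rewrite mem_filter => /andP[/eqP p12 _].
  apply: t_free => /(congr1 (fun g => g * val p.1)%g).
  by rewrite mulgVK mul1g => /val_inj/esym.
exists y => // g h gh; apply: contrapT => /eqP gNh.
apply: (Ay (g, h)); first by rewrite mem_filter gNh mem_enum.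
rewrite /A /= -[y in LHS](homeo_invK (t (val g))).
have := tM (val h * (val g)^-1)%g (val g); rewrite mulgVK => /funeqP/(_ _)/= <-.
by rewrite gh homeo_invK.
Qed.

(** * Lower bound for the norm of a sum of weighted translations *)

Section WeightedTranslations.
Context {R : realType} {X : topologicalType} {E : normedModType R[i]}.
Context {G : groupType} (t : G -> homeomorphism X) (F : {fset G}).
Variable a : F -> 'Cb(X, 'L(E)).

Let T : 'L('Cb(X, E)) :=
  \sum_(g : F) multiplication (a g) * translation (t (val g)).

Lemma weighted_translationsE (f : 'Cb(X, E)) x :
  T f x = \sum_(g : F) a g x (f (homeo_inv (t (val g)) x)).
Proof. by rewrite /T bounded_operator_sum bounded_continuous_sum. Qed.

(** By contradiction: a strict excess over [rnorm T] at [x] persists near [x], hence at some [y]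
    whose preimages under the [t g] are distinct; interpolating [f] there gives [u] in the unit ball
    with [T u y] too large. *)
Lemma weighted_translations_ge (f : F -> E) x :
  hausdorff_space X -> completely_regular_space X ->
  (forall g h : G, t (g * h)%g = t g \o t h :> (X -> X)) ->
  topologically_free t -> (forall g, rnorm (f g) <= 1) ->
  rnorm (\sum_(g : F) a g x (f g)) <= rnorm T.
Proof.
move=> hX cX tM t_free f1; rewrite leNgt; apply/negP => Tx.
have cst_cb (v : E) : (fun=> v) \in @continuous_bounded R X E.
  apply/continuous_boundedP; split; first exact: cst_continuous.
  by exists (rnorm v) => //; exact: rnorm_ge0.
(* Multiplication operators applied to constant functions make [h] continuous by construction. *)
pose h := \sum_(g : F) multiplication (a g) (BoundedContinuous (cst_cb (f g))).
have hE y : h y = \sum_(g : F) a g y (f g) by rewrite /h bounded_continuous_sum.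
have [||y Uy yI] :=
  @free_orbit X G t F [set y | rnorm T < rnorm (h y)]° hX tM t_free.
- exact: open_interior.
- exists x; rewrite -hE in Tx.
  have /continuous_rnormP := @bounded_continuous_continuous _ _ _ h x.
  move=> /(_ (rnorm (h x) - rnorm T)); rewrite subr_gt0 => /(_ Tx).
  apply: filterS => y /=; rewrite ltrBrDr => hxy.
  have := rnormD (h x - h y) (h y); rewrite subrK => hx.
  by rewrite -(ltrD2l (rnorm (h x - h y))) (lt_le_trans hxy).
have [u u1 uf] := interpolation hX cX yI f1.
have := interior_subset Uy; rewrite /= ltNge => /negP; apply.
have -> : h y = T u y.
  by rewrite hE weighted_translationsE; apply: eq_bigr => g _; rewrite uf.
rewrite (le_trans (supnormP (T u) y))// (le_trans (opnormP T u))//.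
by rewrite ler_piMr// opnorm_ge0.
Qed.

End WeightedTranslations.

Theorem theorem4p2 (R : realType) (X : topologicalType)
  (X_ne : [set: X] !=set0)
  (X_hausdorff : hausdorff_space X)
  (X_cr : completely_regular_space X)
  (E : completeNormedModType R[i])
  (E_ne0 : exists v : E, v != 0)
  (G : groupType) (t : G -> homeomorphism X)
  (tM : forall g h : G, t (g * h)%g = t g \o t h :> (X -> X))
  (t_free : topologically_free t)
  (F : {fset G}) (F_ne : F != fset0)
  (a : F -> 'Cb(X, 'L(E))) :
  (rnorm (\sum_(g : F) multiplication (a g) * translation (t (val g))
          : 'L('Cb(X, E))))%:E =
    ereal_sup [set ereal_sup [set (rnorm (\sum_(g : F) a g x (f g)))%:E
                             | f in sphere_family F E] | x in [set: X]]
  /\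
  ereal_sup [set ereal_sup [set (rnorm (\sum_(g : F) a g x (f g)))%:E
                           | f in sphere_family F E] | x in [set: X]] =
    ereal_sup [set ereal_sup [set (rnorm (\sum_(g : F) a g x (f g)))%:E
                             | f in ball_family F E] | x in [set: X]].
Proof.
set S := ereal_sup [set ereal_sup [set _ | _ in sphere_family F E] | _ in _].
set B := ereal_sup [set ereal_sup [set _ | _ in ball_family F E] | _ in _].
have S_ub x f : sphere_family F E f ->
    ((rnorm (\sum_(g : F) a g x (f g)))%:E <= S)%E.
  move=> f1; apply: le_ereal_sup_tmp; eexists; first by exists x.
  by apply: ereal_sup_ubound; exists f.
have B_ub x f : ball_family F E f ->
    ((rnorm (\sum_(g : F) a g x (f g)))%:E <= B)%E.
  move=> f1; apply: le_ereal_sup_tmp; eexists; first by exists x.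
  by apply: ereal_sup_ubound; exists f.
have SB : S = B.
  apply/eqP; rewrite eq_le; apply/andP; split.
    apply: ge_ereal_sup => _ [x _ <-]; apply: ge_ereal_sup => _ [f f1 <-].
    by apply: B_ub => g; rewrite f1.
  apply: ge_ereal_sup => _ [x _ <-]; apply: ge_ereal_sup => _ [f f1 <-].
  (* Each [f g] is the mean of two unit vectors, so by linearity the sum is the mean of two sums
     over sphere families. *)
  have [p pP] := choice (fun g => ball_midpoint_sphere E_ne0 (f1 g)).
  have p1 : sphere_family F E (fun g => (p g).1) by move=> g; have [] := pP g.
  have p2 : sphere_family F E (fun g => (p g).2) by move=> g; have [] := pP g.
  have -> : \sum_(g : F) a g x (f g) =
      (2^-1 : R)%:C%C *: (\sum_(g : F) a g x (p g).1 + \sum_(g : F) a g x (p g).2).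
    rewrite -big_split scaler_sumr; apply: eq_bigr => g _ /=.
    have [_ _ {1}->] := pP g.
    by rewrite linearZ linearD/= fmorphV rmorph_nat.
  have := S_ub x _ p1; have := S_ub x _ p2.
  set v := \sum_g _; set w := \sum_g _ => vS wS.
  (* The norm of a mean is at most the larger of the two norms, and each of these is at most [S]. *)
  have vw : rnorm ((2^-1 : R)%:C%C *: (w + v)) <= Num.max (rnorm w) (rnorm v).
    rewrite rnormZ Re_norm_real ger0_norm// ler_pdivrMl//.
    rewrite (le_trans (rnormD _ _))// mulr_natl mulr2n.
    by rewrite lerD// le_max lexx ?orbT.
  have /le_trans -> // : ((rnorm ((2^-1 : R)%:C%C *: (w + v)))%:E <=
      (Num.max (rnorm w) (rnorm v))%:E)%E by rewrite lee_fin.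
  by rewrite /Num.max; case: ifP.
split => //; apply/eqP; rewrite eq_le; apply/andP; split; last first.
  apply: ge_ereal_sup => _ [x _ <-]; apply: ge_ereal_sup => _ [f f1 <-].
  rewrite lee_fin; apply: weighted_translations_ge => // g.
  by rewrite rnorm_le1 f1.
have [x0 _] := X_ne.
set T := \sum_g _; have [T0 T_ub] := opnorm_has_sup T.
(* The real suprema defining the operator norm and then the sup norm become extended ones; this
   requires nonempty bounded sets, hence [x0]. *)
rewrite SB rnorm_opnorm /opnorm -ereal_sup_EFin//.
apply: ge_ereal_sup => _ [_ [u u1 <-] <-].
rewrite rnorm_supnorm /supnorm -ereal_sup_EFin; last 2 first.
- by exists (rnorm (T u)) => _ [x _ <-]; exact: supnormP.
- by exists (rnorm (T u x0)), x0.
apply: ge_ereal_sup => _ [_ [x _ <-] <-].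
(* The values of [u] at the preimages of [x] have norm at most 1, not exactly 1, which is why [S]
   was replaced by [B]. *)
rewrite /T weighted_translationsE; apply: (B_ub _ (fun g => _)) => g.
by rewrite -rnorm_le1 (le_trans (supnormP _ _)).
Qed.
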